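(* Let $G$ be a countable group with an effective minimal non-elementary convergence group action $(\rho,X)$. Then for every non-trivial subnormal subgroup $N$ of $G$, the restricted action $(\rho|_N,X)$ is an effective minimal non-elementary convergence group action of $N$. In particular $G$ is a strongly Powers group.
   Context: Convergence group action: Let $G$ be a countable group, $X$ a compact metrizable space and $\rho:G\to \mathrm{Homeo}(X)$ a homomorphism. The pair $(\rho,X)$ is a convergence group action of $G$ if $X$ has at least three points and, for any infinite sequence $\{g_i\}$ of mutually different elements of $G$, there exist a subsequence $\{g_{i_j}\}$ and two (possibly equal) points $r,a\in X$ such that $\rho(g_{i_j})|_{X\setminus\{r\}}$ converges to (the constant map) $a$ uniformly on compact subsets of $X\setminus\{r\}$ and $\rho(g_{i_j}^{-1})|_{X\setminus\{a\}}$ converges to $r$ uniformly on compact subsets of $X\setminus\{a\}$. Such a sequence $\{g_{i_j}\}$ is called a convergence sequence, with repelling point $r$ and attracting point $a$. The limit set $\Lambda(\rho)\subset X$ is the set of all repelling points and attracting points of convergence sequences of $(\rho,X)$. The action is non-elementary if $\Lambda(\rho)$ is infinite. It is minimal if every $\rho(G)$-orbit is dense in $X$, and effective if $\rho$ is injective. Powers group: A group $G$ is a Powers group if $G\neq\{1\}$ and, for every finite subset $F\subset G\setminus\{1\}$ and every integer $N\ge 1$, there exist a partition $G=C\sqcup D$ and elements $\gamma_1,\dots,\gamma_N\in G$ such that $fC\cap C=\emptyset$ for all $f\in F$ and $\gamma_jD\cap\gamma_kD=\emptyset$ for all $j\neq k$ in $\{1,\dots,N\}$. A group is a strongly Powers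 group if all its non-trivial subnormal subgroups are Powers groups, where a subgroup $N\le G$ is subnormal if there is a finite chain $N=N_k<N_{k-1}<\cdots<N_0=G$ with $N_j$ normal in $N_{j-1}$ for each $j=1,\dots,k$. *)

(* Defs.v *)
From HB Require Import structures.
From mathcomp Require Import all_boot all_order all_algebra.
From mathcomp Require Import all_classical all_reals all_analysis.

Set Implicit Arguments.
Unset Strict Implicit.
Unset Printing Implicit Defensive.

Local Open Scope classical_set_scope.
Local Open Scope group_scope.

Record subgroup (G : groupType) := Subgroup {
  subgroup_set :> set G;
  subgroup1 : subgroup_set 1;
  subgroupM : forall x y, subgroup_set x -> subgroup_set y ->
    subgroup_set (x * y);
  subgroupV : forall x, subgroup_set x -> subgroup_set x^-1 }.

Definition subgroup_type (G : groupType) (H : subgroup G) : Type :=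
  {x : G | x \in subgroup_set H}.

Section SubgroupType.
Variables (G : groupType) (H : subgroup G).

HB.instance Definition _ :=
  SubChoice.copy (subgroup_type H) {x : G | x \in subgroup_set H}.

Fact subgroup_group_closed : group_closed (mem (subgroup_set H)).
Proof.
split; first exact/mem_set/subgroup1.
move=> x y /set_mem Hx /set_mem Hy; apply/mem_set.
by apply: subgroupM => //; exact: subgroupV.
Qed.

HB.instance Definition _ := SubChoice_isSubGroup.Build G
  (mem (subgroup_set H)) (subgroup_type H) subgroup_group_closed.

End SubgroupType.

Definition nontrivial (G : groupType) : Prop := exists g : G, g <> 1.

Definition normal_in (G : groupType) (A B : subgroup G) : Prop :=
  A `<=` B /\
  forall b a, subgroup_set B b -> subgroup_set A a ->
    subgroup_set A (b * a * b^-1).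

Definition subnormal (G : groupType) (N : subgroup G) : Prop :=
  exists (k : nat) (C : nat -> subgroup G),
    [/\ C 0%N = [set: G] :> set G,
        C k = N :> set G
      & forall j, (0 < j <= k)%N -> C j `<` C j.-1 /\ normal_in (C j) (C j.-1)].

Definition powers_group (G : groupType) : Prop :=
  nontrivial G /\
  forall F : set G, finite_set F -> F `<=` ~` [set 1] ->
  forall n : nat, (1 <= n)%N ->
  exists (C D : set G) (gamma : 'I_n -> G),
    [/\ C `|` D = [set: G], C `&` D = set0,
        forall f, F f -> [set f * c | c in C] `&` C = set0
      & forall j k, j <> k ->
          [set gamma j * d | d in D] `&` [set gamma k * d | d in D] = set0].

Definition strongly_powers_group (G : groupType) : Prop :=
  forall N : subgroup G, subnormal N -> nontrivial (subgroup_type N) ->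
    powers_group (subgroup_type N).

Definition homeomorphism (X : topologicalType) (f : X -> X) : Prop :=
  continuous f /\
  exists f' : X -> X, [/\ continuous f', cancel f f' & cancel f' f].

(* A metrizable space is given with a compatible metric; the notions below
   depend only on the topology when X is compact. *)
Section Convergence.
Context {R : realType} {X : metricType R} {G : groupType}.
Implicit Type rho : G -> X -> X.

Definition cvg_const_off (f : nat -> X -> X) (p q : X) : Prop :=
  {family compactly_in (~` [set p]), f @ \oo --> cst q}.

Definition convergence_sequence rho (g : nat -> G) (r a : X) : Prop :=
  [/\ injective g,
      cvg_const_off (fun i => rho (g i)) r a
    & cvg_const_off (fun i => rho (g i)^-1) a r].

(* A homomorphism from G to Homeo(X) is given as [rho : G -> X -> X] subject
   to [cga_homeo] and [cga_mul]. *)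
Record convergence_group_action rho : Prop := {
  cga_countable : countable [set: G];
  cga_compact : compact [set: X];
  cga_homeo : forall g, homeomorphism (rho g);
  cga_mul : forall g h, rho (g * h) = rho g \o rho h;
  cga_three_points : exists x y z : X, [/\ x <> y, y <> z & x <> z];
  cga_convergence : forall g : nat -> G, injective g ->
    exists2 s : nat -> nat, {homo s : i j / (i < j)%N} &
      exists r a : X, convergence_sequence rho (g \o s) r a }.

Definition limit_set rho : set X :=
  [set x | exists (g : nat -> G) (r a : X),
     convergence_sequence rho g r a /\ (x = r \/ x = a)].

Definition nonelementary rho : Prop := infinite_set (limit_set rho).

Definition minimal rho : Prop := forall x, dense [set rho g x | g in [set: G]].

Definition effective rho : Prop := injective rho.

End Convergence.

Definition restrict_action (G : groupType) (N : subgroup G) (X : Type)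
  (rho : G -> X -> X) : subgroup_type N -> X -> X := fun n => rho (\val n).
Arguments restrict_action {G} N {X} rho _ _.

(* Main.v *)
(* Let [B] be a nontrivial normal subgroup of [A], where [A] is infinite and
   acts minimally on the infinite space [X]. The fixed points of [B] form a
   closed [A]-invariant set, which is empty because the action is effective. If
   [B] were finite, the attracting point of a convergence sequence [g i] of [A]
   would be fixed by [B], as [B] commutes with [g i] up to conjugation inside a
   finite group; so [B] is infinite. Its convergence sequences, conjugated by
   [A], then show that every [B]-orbit, having at least two points, is dense.
   Descending the subnormal chain gives the first part.

   For the Powers property, a nontrivial element fixes no nonempty open set
   pointwise, so a given finite set [F] displaces some nonempty open [U] from
   itself; take for [C] the elements mapping a base point into [U]. A convergence
   sequence repelling from a point of [U] contracts the complement of [U] into a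
   small neighborhood of a point [a], and minimality provides arbitrarily many
   pairwise disjoint translates of this neighborhood. *)

Require Import Defs.
From HB Require Import structures.
From mathcomp Require Import all_boot all_order all_algebra.
From mathcomp Require Import all_classical all_reals all_analysis.

Set Implicit Arguments.
Unset Strict Implicit.

Local Open Scope classical_set_scope.

(** * Infinite sets and separation in Hausdorff spaces *)

Lemma infinite_injection (T : Type) (A : set T) : infinite_set A ->
  exists2 f : nat -> T, injective f & forall i, A (f i).
Proof.
move=> /infiniteP/card_leP[f]; exists (fun i => val (f (to_setT i))).
  move=> i j /val_inj/(@inj _ _ setT f _ _ (mem_set I) (mem_set I)).
  by move=> /(congr1 val).
by move=> i; exact: set_valP.
Qed.

Lemma infinite_avoid (T : Type) (S : set T) :
  infinite_set [set: T] -> finite_set S -> exists x, ~ S x.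
Proof.
by move=> Tinf Sfin; have /infinite_setN0[x [_ Sx]] := infinite_setD Tinf Sfin;
  exists x.
Qed.

Lemma dense_infinite (T : topologicalType) (S : set T) : hausdorff_space T ->
  infinite_set [set: T] -> dense S -> infinite_set S.
Proof.
move=> hT Tinf Sd Sfin; have [x Sx] := infinite_avoid Tinf Sfin.
have Sc : closed S by apply: compact_closed => //; exact: finite_compact.
have [||y [nSy Sy]] := Sd (~` S); [by exists x | exact: closed_openC | ].
exact: nSy.
Qed.

Lemma hausdorff_disjoint_open (T : topologicalType) (x y : T) :
  hausdorff_space T -> x <> y ->
  exists U V : set T, [/\ open U, open V, U x, V y & forall z, U z -> ~ V z].
Proof.
rewrite open_hausdorff => hT /eqP/hT[[U V]/= [/set_mem Ux /set_mem Vy] [oU oV]].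
move=> /eqP UV; exists U, V; split => // z Uz Vz.
by have : (U `&` V) z by []; rewrite UV.
Qed.

(** * Convergence to a constant map off a point *)

Section Convergence.
Context {R : realType} {X : metricType R}.
Implicit Types (U V W K : set X) (x y z p q : X).

(** The limit is constant, so uniform closeness to it on [K] amounts to landing in one neighborhood
    of [q]: entourages reduce to open sets. *)
Lemma cvg_const_offP (f : nat -> X -> X) p q :
  cvg_const_off f p q <->
  forall K U, compact K -> ~ K p -> open U -> U q ->
    \forall i \near \oo, forall x, K x -> U (f i x).
Proof.
rewrite /cvg_const_off fam_cvgP; split=> [fpq K U Kc Kp Uo Uq|fpq K [Kp Kc] P].
  have Kin : compactly_in (~` [set p]) K.
    by split=> // x Kx xp; apply: Kp; rewrite -xp.
  have : nbhs q U by exact: open_nbhs_nbhs.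
  rewrite -nbhs_entourageE => -[E entE EU].
  have KE : nbhs (cst q : {uniform` K -> X})
      [set h | forall y, K y -> E (q, h y)].
    by apply/uniform_nbhs; exists E; split.
  have : \forall i \near \oo, forall x, K x -> E (q, f i x).
    exact: (fpq K Kin _ KE).
  apply: filterS.
  by move=> i h x Kx; apply: EU; apply/xsectionP; exact: h.
move=> /uniform_nbhs[E [entE EP]].
have qE := nbhs_entourage q entE.
have := fpq K (interior (xsection E q)) Kc (fun h => Kp p h erefl)
  (@open_interior _ _) qE.
rewrite /=; apply: filterS => i fK; apply: EP => x Kx /=.
by apply/xsectionP; apply: interior_subset; exact: fK.
Qed.

Lemma cvg_const_off_finite (f : nat -> X -> X) p q K U :
  cvg_const_off f p q -> finite_set K -> ~ K p -> open U -> U q ->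
  exists i, forall x, K x -> U (f i x).
Proof.
move=> /cvg_const_offP fpq Kfin Kp Uo Uq.
by have /= [i _ /(_ _ (leqnn i))] := fpq K U (finite_compact Kfin) Kp Uo Uq; exists i.
Qed.

Lemma cvg_const_off1 (f : nat -> X -> X) p q x U :
  cvg_const_off f p q -> x <> p -> open U -> U q -> exists i, U (f i x).
Proof.
move=> fpq xp Uo Uq.
have [|i fi] := cvg_const_off_finite fpq (finite_set1 x) _ Uo Uq.
  by move=> /esym.
by exists i; exact: fi.
Qed.

End Convergence.

Local Open Scope group_scope.

(** * Convergence sequences and fixed points of the action *)

Section Action.
Context {R : realType} {X : metricType R} {G : groupType} {rho : G -> X -> X}.
Hypothesis cga : convergence_group_action rho.
Implicit Types (g h k f : G) (U V W K : set X) (x y z p q r a : X).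

Lemma act_continuous g : continuous (rho g).
Proof. by have [] := cga_homeo cga g. Qed.

Lemma act_open g U : open U -> open (rho g @^-1` U).
Proof. by move=> Uo; apply: open_comp => // x _; exact: act_continuous. Qed.

Lemma actM g h x : rho (g * h) x = rho g (rho h x).
Proof. by rewrite (cga_mul cga). Qed.

Lemma act_inj g : injective (rho g).
Proof. by have [_ [f [_ /can_inj]]] := cga_homeo cga g. Qed.

Lemma act1 x : rho 1 x = x.
Proof. by apply: (@act_inj 1); rewrite -actM mulg1. Qed.

Lemma actK g : cancel (rho g) (rho g^-1).
Proof. by move=> x; rewrite -actM mulVg act1. Qed.

Lemma actVK g : cancel (rho g^-1) (rho g).
Proof. by move=> x; rewrite -actM mulgV act1. Qed.

Lemma act_moved_open U x g : open U -> U x -> rho g x <> x ->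
  exists V, [/\ open V, V x, V `<=` U & forall y, V y -> ~ V (rho g y)].
Proof.
move=> Uo Ux gx.
have [P [Q [Po Qo Pgx Qx PQ]]] := hausdorff_disjoint_open (@metric_hausdorff _ X) gx.
exists (U `&` Q `&` (rho g @^-1` P)); split => //.
- by apply: openI; [exact: openI|exact: act_open].
- by move=> y [[]].
- by move=> y [_ Pgy] [[_ /(PQ _ Pgy)]].
Qed.

(** Left multiplication carries the attracting point along, so the limit set contains the orbit of
    every attracting point. *)
Lemma convergence_sequence_mull (g : nat -> G) r a h : convergence_sequence rho g r a ->
  convergence_sequence rho (fun i => h * g i) r (rho h a).
Proof.
move=> [ginj /cvg_const_offP gra /cvg_const_offP gar]; split.
- by move=> i j /mulgI/ginj.
- apply/cvg_const_offP => K U Kc Kr Uo Uha.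
  have := gra K _ Kc Kr (act_open h Uo) Uha.
  by apply: filterS => i giK x Kx; rewrite actM; exact: giK.
- apply/cvg_const_offP => K U Kc Kha Uo Ur.
  have hKc : compact [set rho h^-1 x | x in K].
    apply: continuous_compact => //; apply: continuous_subspaceT.
    exact: act_continuous.
  have := gar [set rho h^-1 x | x in K] U hKc _ Uo Ur.
  have hKa : ~ [set rho h^-1 x | x in K] a.
    by move=> [x Kx xa]; apply: Kha; rewrite -xa actVK.
  move=> /(_ hKa); apply: filterS => i giK x Kx.
  by rewrite invgM actM; apply: giK; exists x.
Qed.

Lemma infinite_convergence_sequence (A : set G) : infinite_set A ->
  exists (g : nat -> G) r a, (forall i, A (g i)) /\ convergence_sequence rho g r a.
Proof.
move=> /infinite_injection[g ginj gA].
have [s _ [r [a gsra]]] := cga_convergence cga ginj.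
by exists (g \o s), r, a; split => // i; exact: gA.
Qed.

Lemma fixed_attracting (g : nat -> G) r a x : convergence_sequence rho g r a ->
  (forall i, rho (g i) x = x) -> x <> r -> x = a.
Proof.
move=> [_ gra _] gx xr; apply: contrapT => xa.
have [U [V [Uo Vo Ux Va UV]]] := hausdorff_disjoint_open (@metric_hausdorff _ X) xa.
by have [i] := cvg_const_off1 gra xr Vo Va; rewrite gx; exact: UV.
Qed.

(** Infinitely many such elements would contain a convergence sequence, whose common fixed points
    can only be [r] or [a]: too few for three distinct points. *)
Lemma stabilizer3_finite x y z : x <> y -> y <> z -> x <> z ->
  finite_set [set g | [/\ rho g x = x, rho g y = y & rho g z = z]].
Proof.
move=> xy yz xz; apply: contrapT => /infinite_convergence_sequence.
move=> [g [r [a [gfix gra]]]].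
have fixP p : (forall i, rho (g i) p = p) -> p = r \/ p = a.
  move=> gp; have [pr|pr] := pselect (p = r); first by left.
  by right; exact: fixed_attracting gra gp pr.
have [|xr|xa] := fixP x; first by move=> i; have [] := gfix i.
  have [|yr|ya] := fixP y; first by move=> i; have [] := gfix i.
    by apply: xy; rewrite xr yr.
  have [|zr|za] := fixP z; first by move=> i; have [] := gfix i.
    by apply: xz; rewrite xr zr.
  by apply: yz; rewrite ya za.
have [|yr|ya] := fixP y; first by move=> i; have [] := gfix i.
  have [|zr|za] := fixP z; first by move=> i; have [] := gfix i.
    by apply: yz; rewrite yr zr.
  by apply: xz; rewrite xa za.
by apply: xy; rewrite xa ya.
Qed.

Lemma nonelementary_of_infinite : infinite_set [set: X] ->
  infinite_set [set: G] -> minimal rho -> nonelementary rho.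
Proof.
move=> Xinf /infinite_convergence_sequence[g [r [a [_ gra]]]] rmin.
apply: (@sub_infinite_set _ [set rho h a | h in [set: G]]).
  move=> _ [h _ <-]; exists (fun i => h * g i), r, (rho h a).
  by split; [exact: convergence_sequence_mull|right].
by apply: dense_infinite => //; exact: metric_hausdorff.
Qed.

Hypothesis rho_effective : effective rho.

Lemma effective_moves g : g <> 1 -> exists x, rho g x <> x.
Proof.
move=> g1; apply: contrapT => nex; apply: g1; apply: rho_effective.
apply/funext => x; rewrite act1; apply: contrapT => gx.
by apply: nex; exists x.
Qed.

Lemma effective_moves_off g a : g <> 1 -> exists2 x, x <> a & rho g x <> x.
Proof.
move=> /effective_moves[x gx]; have [xa|xa] := pselect (x = a); last by exists x.
exists (rho g x); first by rewrite -xa.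
by move=> /act_inj.
Qed.

(** * Nontrivial normal subgroups of a minimal group *)

Section NormalStep.
Hypothesis X_infinite : infinite_set [set: X].
Variables A B : subgroup G.
Hypothesis BA : normal_in B A.
Hypothesis A_minimal : forall x, dense [set rho g x | g in A].
Hypothesis A_infinite : infinite_set A.
Hypothesis B_nontrivial : exists2 b, subgroup_set B b & b <> 1.

Lemma normal_conjV b g : subgroup_set A g ->
  subgroup_set B b -> subgroup_set B (g^-1 * b * g).
Proof.
by move=> Ag Bb; rewrite -{2}[g]invgK; apply: BA.2 => //; exact: subgroupV.
Qed.

(** By normality the [A]-orbit of a [B]-fixed point is [B]-fixed; being dense, it meets an open set
    that some [b] in [B] displaces. *)
Lemma normal_no_fixed_point x : ~ forall b, subgroup_set B b -> rho b x = x.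
Proof.
move=> Bx; have [b Bb /effective_moves[y byy]] := B_nontrivial.
have [V [Vo Vy _ bV]] := act_moved_open openT I byy.
have [|_ [/[swap] [[g Ag <-]] Vgx]] := @A_minimal x V _ Vo; first by exists y.
apply: (bV _ Vgx).
suff -> : rho b (rho g x) = rho g x by [].
by apply: (@act_inj g^-1); rewrite -!actM Bx ?mulVg ?act1 //;
  exact: normal_conjV.
Qed.

Lemma normal_infinite : infinite_set B.
Proof.
move=> Bfin; have [g [r [a [gA gra]]]] := infinite_convergence_sequence A_infinite.
have [_ gcvg _] := gra.
have Brfin : finite_set [set rho b r | b in B] by exact: finite_image.
(* Off the [B]-orbit of [r], so that the finite orbit of [x] avoids [r] and is contracted as a whole
   towards [a]. *)
have [x xBr] := infinite_avoid X_infinite Brfin.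
apply: (@normal_no_fixed_point a) => b Bb; apply: contrapT => baa.
have [V [Vo Va _ bV]] := act_moved_open openT I baa.
have Bxfin : finite_set [set rho c x | c in B] by exact: finite_image.
have [|i giV] := cvg_const_off_finite gcvg Bxfin _ Vo Va.
  move=> [c Bc cx]; apply: xBr; exists c^-1; first exact: subgroupV.
  by rewrite -cx actK.
have Vgx : V (rho (g i) x).
  by apply: giV; exists 1; [exact: subgroup1|exact: act1].
apply: (bV _ Vgx).
(* Moving [b] across [g i] turns it into another element of [B], so the [b]-image of [rho (g i) x]
   also lies in [V], which [b] displaces. *)
have -> : rho b (rho (g i) x) = rho (g i) (rho ((g i)^-1 * b * g i) x).
  by rewrite -!actM !mulgA mulgV mul1g.
by apply: giV; exists ((g i)^-1 * b * g i) => //; exact: normal_conjV.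
Qed.

(* The [B]-orbit of [x] contains a point other than [x], so one of the two is
   not repelled by the conjugate [h * g i * h^-1] of a convergence sequence of
   [B], and its translates accumulate at [rho h a]. *)
Lemma normal_minimal x : dense [set rho b x | b in B].
Proof.
move=> U U0 Uo.
have [g [r [a [gB [_ gra _]]]]] := infinite_convergence_sequence normal_infinite.
have [_ [/[swap] [[h Ah <-]] Uha]] := @A_minimal a U U0 Uo.
have [c Bc chx] : exists2 c, subgroup_set B c & rho h^-1 (rho c x) <> r.
  apply: contrapT => nex; apply: (@normal_no_fixed_point x) => b Bb.
  have Br c : subgroup_set B c -> rho h^-1 (rho c x) = r.
    by move=> Bc; apply: contrapT => chx; apply: nex; exists c.
  apply: (@act_inj h^-1); rewrite Br //.
  by rewrite -(Br 1) ?act1 //; exact: subgroup1.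
have [i Ugi] := cvg_const_off1 gra chx (act_open h Uo) Uha.
exists (rho (h * g i * h^-1 * c) x); split; first by rewrite !actM.
exists (h * g i * h^-1 * c) => //; apply: subgroupM => //.
by apply: BA.2.
Qed.

End NormalStep.

(** * The Powers property *)

Hypothesis rho_minimal : minimal rho.
Hypothesis rho_nonelementary : nonelementary rho.

Lemma nonelementary_infinite : infinite_set [set: X].
Proof. by apply: sub_infinite_set rho_nonelementary. Qed.

Lemma nonelementary_sequence : exists (g : nat -> G) r a, convergence_sequence rho g r a.
Proof.
by have /infinite_setN0[_ [g [r [a [gra _]]]]] := rho_nonelementary;
  exists g, r, a.
Qed.

(* If [f] fixed [U] pointwise, its conjugates by a sequence contracting
   [~` [set a]] into [U] would fix any prescribed finite set off [a]: three
   points, which leaves finitely many candidates for the conjugate, together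
   with one point moved by each of these candidates. *)
Lemma moved_point_in_open f U : f <> 1 -> open U -> U !=set0 ->
  exists2 x, U x & rho f x <> x.
Proof.
move=> f1 Uo U0; apply: contrapT => nex.
have Ufix x : U x -> rho f x = x.
  by move=> Ux; apply: contrapT => fx; apply: nex; exists x.
have [g [r [a [_ _ gar]]]] := nonelementary_sequence.
have [_ [/[swap] [[k _ <-]] Ukr]] := @rho_minimal r U U0 Uo.
have Xinf := nonelementary_infinite.
have [x xa] := infinite_avoid Xinf (finite_set1 a).
have [y yxa] := infinite_avoid Xinf (finite_set2 x a).
have [z zxya] : exists z, ~ ([set x; y] `|` [set a]) z.
  by apply: infinite_avoid => //; rewrite finite_setU; split.
have xy : x <> y by move=> xy; apply: yxa; left.
have yz : y <> z by move=> yz; apply: zxya; left; right.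
have xz : x <> z by move=> xz; apply: zxya; left; left.
have Sfin := stabilizer3_finite xy yz xz.
set S := [set h | _] in Sfin.
(* The trivial element moves nothing; its default value [x] only has to differ from [a], so that [Y]
   below avoids [a]. *)
have /choice[m mP] : forall h, exists p, p <> a /\ (h <> 1 -> rho h p <> p).
  move=> h; have [->|/(effective_moves_off a)[p pa hp]] := pselect (h = 1).
    by exists x.
  by exists p.
pose Y := [set x; y; z] `|` [set m h | h in S].
have Yfin : finite_set Y.
  rewrite !finite_setU; split; first by do ?split.
  exact: finite_image.
have Ya : ~ Y a.
  move=> [[[ax|ay]|az]|[h _ mh]].
  - by apply: xa; rewrite /= ax.
  - by apply: yxa; rewrite /= ay; right.
  - by apply: zxya; rewrite /= az; right.
  - by have [] := mP h.
have [i giY] := cvg_const_off_finite gar Yfin Ya (act_open k Uo) Ukr.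
pose c := k * (g i)^-1; pose f' := c^-1 * f * c.
have f'Y p : Y p -> rho f' p = p.
  move=> Yp; have Ucp : U (rho c p) by rewrite actM; exact: giY.
  by rewrite 2!actM (Ufix _ Ucp) actK.
have f'1 : f' <> 1.
  rewrite /f'; move: (c) => d /(congr1 (fun t => d * t * d^-1)).
  by rewrite !mulgA mulgV mul1g mulgK mulg1 mulgV.
have [_ /(_ f'1)] := mP f'; apply; apply: (f'Y _); right; exists f' => //.
by split; apply: f'Y; left; [left; left|left; right|right].
Qed.

(** Induction on [s]: shrink the open set found so far around one of its points that the next
    element moves; displacement passes to smaller sets. *)
Lemma displaced_open (s : seq G) : (forall f, f \in s -> f <> 1) ->
  exists U, [/\ open U, U !=set0 & forall f x, f \in s -> U x -> ~ U (rho f x)].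
Proof.
elim: s => [_|f s IHs fs1].
  have [r] := infinite_setN0 nonelementary_infinite.
  by exists setT; split=> //; [exact: openT|exists r].
have [|U [Uo U0 sU]] := IHs; first by move=> h hs; apply: fs1; rewrite inE hs orbT.
have [|x Ux fx] := @moved_point_in_open f U _ Uo U0.
  by apply: fs1; rewrite inE eqxx.
have [V [Vo Vx VU fV]] := act_moved_open Uo Ux fx.
exists V; split => //; first by exists x.
move=> h y; rewrite inE => /orP[/eqP ->|hs Vy Vhy]; first exact: fV.
by apply: (sU h y hs); exact: VU.
Qed.

(** The orbit of [a] is infinite: pick [n] distinct points of it, pull disjoint neighborhoods of
    each pair back to [a], and intersect over the finitely many pairs. *)
Lemma disjoint_translates a n : exists (h : 'I_n -> G) W,
  [/\ open W, W a & forall (j k : 'I_n) x y, j <> k -> W x -> W y ->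
                      rho (h j) x <> rho (h k) y].
Proof.
have /infinite_injection[v vinj vorb] :
    infinite_set [set rho g a | g in [set: G]].
  exact: dense_infinite (@metric_hausdorff _ X) nonelementary_infinite (rho_minimal a).
have /choice[h hv] : forall i, exists g, rho g a = v i.
  by move=> i; have [g _ gv] := vorb i; exists g.
have /choice[W WP] : forall jk : 'I_n * 'I_n, exists W, [/\ open W, W a &
    jk.1 <> jk.2 -> forall x y, W x -> W y -> rho (h jk.1) x <> rho (h jk.2) y].
  move=> [j k] /=; have [jk|jk] := pselect (j = k).
    by exists setT; split=> //; exact: openT.
  have hjk : rho (h j) a <> rho (h k) a by rewrite !hv => /vinj/val_inj.
  have [P [Q [Po Qo Pj Qk PQ]]] := hausdorff_disjoint_open (@metric_hausdorff _ X) hjk.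
  exists (rho (h j) @^-1` P `&` rho (h k) @^-1` Q); split=> //.
    by apply: openI; exact: act_open.
  by move=> _ x y [Px _] [_ Qy] xy; apply: (PQ _ Px); rewrite /= xy.
have : nbhs a [set x | forall jk, W jk x].
  by apply: filter_forall => jk; have [Wo Wa _] := WP jk; exact: open_nbhs_nbhs.
rewrite nbhsE => -[V [Vo Va] VW].
exists (h \o val), V; split => // j k x y jk /VW Wx /VW Wy.
have [_ _] := WP (j, k); apply=> //.
Qed.

Theorem powers_group_of_action : powers_group G.
Proof.
split.
  have [g [r [a [ginj _ _]]]] := nonelementary_sequence.
  have [g0|] := pselect (g 0%N = 1); last by exists (g 0%N).
  by exists (g 1%N) => g1; have := ginj 0%N 1%N; rewrite g0 g1 => /(_ erefl).
move=> F /finite_seqP[s ->] F1 n _.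
have [U [Uo U0 FU]] := displaced_open F1.
have [g [r [a [_ /cvg_const_offP gra _]]]] := nonelementary_sequence.
have [_ [/[swap] [[k _ <-]] Ukr]] := @rho_minimal r U U0 Uo.
have [h [W [Wo Wa hW]]] := disjoint_translates a n.
have Kc : compact (~` (rho k @^-1` U)).
  apply: (subclosed_compact _ (cga_compact cga)) => //.
  exact/open_closedC/act_open.
have [|i _ /(_ _ (leqnn i)) giW] := gra _ _ Kc _ Wo Wa; first by apply.
exists [set c | U (rho c r)], (~` [set c | U (rho c r)]),
  (fun j => h j * g i * k^-1); split.
- exact: setUv.
- exact: setICr.
- move=> f Ff; rewrite -subset0 => _ [[c Uc <-] Ufc].
  by apply: (FU f _ Ff Uc); rewrite -actM.
- move=> j l jl; rewrite -subset0 => _ [[d Ud <-] [e Ue el]].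
  have gW c : ~ U (rho c r) -> W (rho (g i) (rho k^-1 (rho c r))).
    by move=> Uc; apply: giW => /=; rewrite actVK.
  have /hW := jl => /(_ _ _ (gW _ Ud) (gW _ Ue)); apply.
  by rewrite -!actM el.
Qed.

End Action.

(** * Restriction of the action to a subgroup *)

Section Restriction.
Context {R : realType} {X : metricType R} {G : groupType} {rho : G -> X -> X}.
Hypothesis cga : convergence_group_action rho.
Variable N : subgroup G.

Lemma restrict_cga : convergence_group_action (restrict_action N rho).
Proof.
split.
- rewrite /= -(eq_countable (inj_card_eq (in2W (@val_inj _ _ (subgroup_type N))))).
  apply: sub_countable (cga_countable cga); exact: subset_card_le.
- exact: cga_compact cga.
- by move=> g; exact: cga_homeo cga _.
- by move=> g h; rewrite /restrict_action -(cga_mul cga) valM.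
- exact: cga_three_points cga.
- move=> g ginj.
  have [s sincr [r [a [gsinj gsra gsar]]]] :=
    cga_convergence cga (inj_comp val_inj ginj).
  by exists s => //; exists r, a; split => // i j /(congr1 val)/gsinj.
Qed.

Lemma restrict_effective : effective rho -> effective (restrict_action N rho).
Proof. by move=> rinj x y /rinj/val_inj. Qed.

Lemma restrict_minimal : (forall x, dense [set rho g x | g in N]) ->
  minimal (restrict_action N rho).
Proof.
move=> Nmin x U U0 Uo; have [_ [/[swap] [[g Ng <-]] Ugx]] := Nmin x U U0 Uo.
exists (rho g x); split => //.
by exists (Sub g (mem_set Ng)) => //; rewrite /restrict_action SubK.
Qed.

Lemma infinite_subgroup_type : infinite_set N ->
  infinite_set [set: subgroup_type N].
Proof.
apply: contra_not => /(finite_image val); apply: sub_finite_set => g Ng.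
by exists (Sub g (mem_set Ng)) => //; rewrite SubK.
Qed.

End Restriction.

(** * Descent along the subnormal chain *)

Theorem corollary3p4 (R : realType) (X : metricType R) (G : groupType)
    (rho : G -> X -> X)
    (G_countable : countable [set: G])
    (rho_cga : convergence_group_action rho)
    (rho_effective : effective rho)
    (rho_minimal : minimal rho)
    (rho_nonelementary : nonelementary rho) :
  (forall N : subgroup G, subnormal N -> nontrivial (subgroup_type N) ->
     [/\ convergence_group_action (restrict_action N rho),
         effective (restrict_action N rho),
         minimal (restrict_action N rho)
       & nonelementary (restrict_action N rho)]) /\
  strongly_powers_group G.
Proof.
have Xinf := nonelementary_infinite rho_nonelementary.
suff main (N : subgroup G) : subnormal N -> nontrivial (subgroup_type N) ->
     [/\ convergence_group_action (restrict_action N rho),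
         effective (restrict_action N rho),
         minimal (restrict_action N rho)
       & nonelementary (restrict_action N rho)].
  split => // N subN ntN; have [Ncga Neff Nmin Nne] := main N subN ntN.
  exact: powers_group_of_action Ncga Neff Nmin Nne.
move=> [k [C [C0 Ck Cnormal]]] [n n1].
have n_in : subgroup_set N (val n) by exact: set_mem (valP n).
have vn1 : val n <> 1%g by move=> vn1; apply: n1; apply: val_inj; rewrite vn1 val1.
(* Going up the chain from [C k], the element [val n] lies in every term, so no term is trivial. *)
have CN j : (j <= k)%N -> subgroup_set (C j) (val n).
  move=> jk; rewrite -(subKn jk).
  elim: (k - j)%N (leq_subr j k) => [_|i IHi ik]; first by rewrite subn0 Ck.
  have [|_ [sub _]] := Cnormal (k - i)%N; first by rewrite subn_gt0 ik leq_subr.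
  by rewrite subnS; apply: sub; apply: IHi; exact: ltnW.
(* Going down, each term inherits what the normal step requires of its ambient group: it is infinite
   and its orbits are dense. *)
have Cmin j : (j <= k)%N ->
    infinite_set (C j) /\ forall x, dense [set rho g x | g in C j].
  elim: j => [_|j IHj jk].
    rewrite C0; split => //.
    have [g [r [a [ginj _ _]]]] := nonelementary_sequence rho_nonelementary.
    by move=> /(finite_preimage (in2W ginj)); exact: infinite_nat.
  have [Cinf Cdense] := IHj (ltnW jk).
  have [//|_ norm] := Cnormal j.+1.
  have nt : exists2 b, subgroup_set (C j.+1) b & b <> 1%g by exists (val n) => //; exact: CN.
  split; first exact: (normal_infinite rho_cga rho_effective Xinf norm).
  exact: (normal_minimal rho_cga rho_effective Xinf norm).
have [Ninf Ndense] := Cmin k (leqnn k); rewrite Ck in Ninf Ndense.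
have Ncga := restrict_cga rho_cga N.
have Nmin := restrict_minimal Ndense.
split => //; first exact: restrict_effective.
apply: nonelementary_of_infinite => //; exact: infinite_subgroup_type.
Qed.
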